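(* For $p>0$ and $x\in(0,\pi/2)$ let $$\varphi_{p,3}(x) = \frac{\sin x}{x} - \frac{2}{\pi} - p\left(\pi^3 - 8x^3\right).$$ Let $p_1 = \frac{2}{3\pi^4} = 0.0068439\ldots$ and $p_2 = \frac{\pi-2}{\pi^4} = 0.011719\ldots$. Then: (i) If $p \in (0, p_1]$, then for all $x\in(0,\pi/2)$ $$\frac{\sin x}{x} > \frac{2}{\pi} + p_1\left(\pi^3-8x^3\right) \geq \frac{2}{\pi} + p\left(\pi^3-8x^3\right).$$ (ii) If $p \in (p_1,p_2)$, then the equation $\varphi_{p,3}(x)=0$ has a unique solution $x_0^{(p)}$ in $(0,\pi/2)$, and $$x \in \left(0,x_0^{(p)}\right) \Longrightarrow \frac{\sin x}{x} > \frac{2}{\pi} + p\left(\pi^3-8x^3\right), \qquad x\in\left(x_0^{(p)},\frac{\pi}{2}\right) \Longrightarrow \frac{\sin x}{x} < \frac{2}{\pi}+p\left(\pi^3-8x^3\right).$$ (iii) If $p\in[p_2,+\infty)$, then for all $x\in(0,\pi/2)$ $$\frac{\sin x}{x} < \frac{2}{\pi} + p_2\left(\pi^3-8x^3\right) \leq \frac{2}{\pi}+p\left(\pi^3-8x^3\right).$$ (iv) For each $p\in(p_1,p_2]$, the function $\varphi_{p,3}$ has exactly one minimum on $(0,\pi/2)$, at a point $m^{(p)}\in(0,\pi/2)$. (v) The equation $\left|\varphi_{p,3}(0+)\right| = \left|\varphi_{p,3}\left(m^{(p)}\right)\right|$ has, for the parameter $p\in(p_1,p_2)$, the solution $p=p_0$,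 numerically determined as $p_0 = 0.010441\ldots$. For the value $$d_0 = \left|\varphi_{p_0,3}(0+)\right| = \left|\varphi_{p_0,3}\left(m^{(p_0)}\right)\right| = 0.039635\ldots$$ it holds $$d_0 = \inf_{p\in(0,\infty)}\ \sup_{x\in(0,\pi/2)} \left|\varphi_{p,3}(x)\right|.$$ Hence the minimax approximant of the family $\varphi_{p,3}$ ($p>0$) is $\varphi_{p_0,3}(x) = \frac{\sin x}{x}-\frac{2}{\pi}-p_0\left(\pi^3-8x^3\right)$, which determines the corresponding minimax approximation $\frac{\sin x}{x}\approx \frac{2}{\pi}+p_0\left(\pi^3-8x^3\right)$.
   Context: ''Minimum'' on the open interval $(0,\pi/2)$ in (iv) means local minimum at an interior point. The notation $f(0+)$ means $\lim_{x\to 0+} f(x)$. Minimax approximant: for a family of functions $\varphi_p(x)$, $x \in (a,b)$, $p \in \mathbb{R}^+ = (0,\infty)$, if the infimum over $p$ of the error $d(p) = \sup_{x\in(a,b)}|\varphi_p(x)|$ is attained at $p = p_0 \in \mathbb{R}^+$, then $\varphi_{p_0}$ is called the minimax approximant of the family on $(a,b)$. A decimal followed by ''$\ldots$'' gives the leading digits of the decimal expansion. *)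

(* Defs.v *)
From Stdlib Require Import Reals.
From Coquelicot Require Import Coquelicot.
Open Scope R_scope.

Definition phi3 (p x : R) : R := sin x / x - 2 / PI - p * (PI ^ 3 - 8 * x ^ 3).

Definition p1 : R := 2 / (3 * PI ^ 4).
Definition p2 : R := (PI - 2) / PI ^ 4.

(* [leading_decimals x k c]: the decimal expansion of the nonnegative real [x],
   cut (not rounded) after [k] decimals, is [c]. *)
Definition leading_decimals (x : R) (k : nat) (c : R) : Prop :=
  c <= x < c + / 10 ^ k.

Definition local_min_on (a b : R) (f : R -> R) (m : R) : Prop :=
  a < m < b /\ locally m (fun y => a < y < b -> f m <= f y).

(* Suprema and infima are taken in the extended reals, so an unbounded error
   is +oo rather than an arbitrary real value. *)
Definition error (a b : R) (f : R -> R) : Rbar :=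
  Lub_Rbar (fun y => exists x, a < x < b /\ y = Rabs (f x)).

Definition minimax_error (a b : R) (phi : R -> R -> R) : Rbar :=
  Rbar_glb (fun d => exists p, 0 < p /\ d = error a b (phi p)).

Definition is_minimax_approximant
    (a b : R) (phi : R -> R -> R) (p0 : R) : Prop :=
  0 < p0 /\ error a b (phi p0) = minimax_error a b phi.

(* Main.v *)
Require Import Defs.
From Stdlib Require Import Reals.
From Coquelicot Require Import Coquelicot.
From Stdlib Require Import Lra Factorial ClassicalEpsilon.
Open Scope R_scope.

(** Everything rests on the factorization
    [phi3 p]'(x) = x^2 (24 p - [slope] x), where [slope] x =
    (sin x - x cos x) / x^4 does not depend on [p] and decreases strictly on
    (0, PI) ([slope_decreasing]).  Since [slope] (PI/2) = 24 [p1], the function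
    [phi3 p] decreases on (0, PI/2) for [p] up to [p1], while for [p] in
    (p1, p2] it decreases up to the unique [m] with [slope m] = 24 p and
    increases afterwards: it is a valley with bottom [m].  As [phi3 p] vanishes
    at PI/2 and tends to [phi3_0 p] = (p2 - p) PI^3 at 0+, its sign is read off
    from this shape ([valley_zero], [valley_neg]).

    For the minimax part, call a valley balanced when the limit at 0 is the
    opposite of the value at the bottom, so that the error is exactly their
    common absolute value ([error_balanced]).  Both [phi3_0 p] and, at each
    fixed [x], [phi3 p x] decrease in [p].  Hence a smaller [p] has a larger
    limit at 0+, and a larger [p] has a more negative value at the balanced
    bottom: no [p] does better than the balanced one ([error_ge_balanced]), and
    two balanced parameters cannot differ ([balanced_not_lt]).

    The balanced valley is found by its bottom rather than by its parameter.
    Substituting 24 p = [slope] m, the balance condition becomes an explicit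
    equation [balance] m = 0, whose root is enclosed between two decimals
    ([left_bracket], [right_bracket]); monotonicity of [slope] turns these into
    bounds on [p0], and the formula for [phi3_0] into bounds on the error.  The
    numerical input consists of Taylor enclosures of sin and cos, from which
    the bounds on PI also come. *)

(** * Taylor enclosures of sin, cos and PI *)

Lemma INR_fact_S (n : nat) : INR (fact (S n)) = INR (S n) * INR (fact n).
Proof. rewrite fact_simpl; apply mult_INR. Qed.

(* The factorials are unfolded inside the reals: as unary natural numbers
   they would be far too large to compute. *)
Ltac expand_taylor :=
  cbn [sum_f_R0 Nat.add Nat.mul]; rewrite ?INR_fact_S;
  change (fact 0) with 1%nat; rewrite ?INR_IZR_INZ;
  cbn [Z.of_nat Pos.of_succ_nat Pos.succ]; field.

Lemma sin_taylor (a : R) : 0 <= a <= 4 ->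
  a - a^3/6 + a^5/120 - a^7/5040 + a^9/362880 - a^11/39916800
    + a^13/6227020800 - a^15/1307674368000 <= sin a
  <= a - a^3/6 + a^5/120 - a^7/5040 + a^9/362880 - a^11/39916800
    + a^13/6227020800 - a^15/1307674368000 + a^17/355687428096000.
Proof.
intros [H0 H4]; destruct (pre_sin_bound a 3 H0 H4) as [Hl Hu]; split.
- eapply Rle_trans; [right | exact Hl].
  unfold sin_approx, sin_term; expand_taylor.
- eapply Rle_trans; [exact Hu | right].
  unfold sin_approx, sin_term; expand_taylor.
Qed.

Lemma cos_taylor (a : R) : -2 <= a <= 2 ->
  1 - a^2/2 + a^4/24 - a^6/720 + a^8/40320 - a^10/3628800
    + a^12/479001600 - a^14/87178291200 <= cos a
  <= 1 - a^2/2 + a^4/24 - a^6/720 + a^8/40320 - a^10/3628800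
    + a^12/479001600 - a^14/87178291200 + a^16/20922789888000.
Proof.
intros [H0 H4]; destruct (pre_cos_bound a 3 H0 H4) as [Hl Hu]; split.
- eapply Rle_trans; [right | exact Hl].
  unfold cos_approx, cos_term; expand_taylor.
- eapply Rle_trans; [exact Hu | right].
  unfold cos_approx, cos_term; expand_taylor.
Qed.

(** PI/2 is where cos changes sign, and the Taylor enclosure decides the sign
    of cos at a decimal on either side of it. *)
Lemma PI_bounds : 3.14159265 < PI < 3.14159266.
Proof.
assert (H1 := PI2_1); split; apply Rnot_le_lt; intros H.
- assert (Hc := cos_le_0 1.570796325 ltac:(lra) ltac:(lra)).
  assert (Ht := cos_taylor 1.570796325 ltac:(lra)). lra.
- assert (Hc := cos_ge_0 1.57079633 ltac:(lra) ltac:(lra)).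
  assert (Ht := cos_taylor 1.57079633 ltac:(lra)). lra.
Qed.

Lemma mult_bounds (a b c d x y : R) :
  0 <= a < x /\ x < b -> 0 <= c < y /\ y < d -> a * c < x * y < b * d.
Proof. intros [] []; split; apply Rmult_le_0_lt_compat; lra. Qed.

Lemma PI_pow_bounds :
  31.0062765 < PI ^ 3 < 31.006277 /\ 97.40909 < PI ^ 4 < 97.409093 /\
  0.3183098855 < / PI < 0.3183098866.
Proof.
assert (HPI := PI_bounds).
assert (H2 := mult_bounds 3.14159265 3.14159266 3.14159265 3.14159266
  PI PI ltac:(lra) ltac:(lra)).
assert (H3 := mult_bounds 3.14159265 3.14159266
  (3.14159265 * 3.14159265) (3.14159266 * 3.14159266)
  PI (PI * PI) ltac:(lra) ltac:(lra)).
assert (H4 := mult_bounds 3.14159265 3.14159266 31.0062765 31.006277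
  PI (PI * (PI * PI)) ltac:(lra) ltac:(lra)).
split; [simpl; lra | split; [simpl; lra | split]].
- apply Rmult_lt_reg_l with PI; [lra|]. rewrite Rinv_r; lra.
- apply Rmult_lt_reg_l with PI; [lra|]. rewrite Rinv_r; lra.
Qed.

Lemma p1_decimals : leading_decimals p1 7 0.0068439.
Proof.
destruct PI_pow_bounds as [_ [H4 _]]; assert (HPI := PI_bounds).
unfold leading_decimals, p1; split.
- apply Rmult_le_reg_r with (3 * PI ^ 4); [lra|].
  replace (2 / (3 * PI ^ 4) * (3 * PI ^ 4)) with 2 by (field; lra). lra.
- apply Rmult_lt_reg_r with (3 * PI ^ 4); [lra|].
  replace (2 / (3 * PI ^ 4) * (3 * PI ^ 4)) with 2 by (field; lra). lra.
Qed.

Lemma p2_decimals : leading_decimals p2 6 0.011719.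
Proof.
destruct PI_pow_bounds as [_ [H4 _]]; assert (HPI := PI_bounds).
unfold leading_decimals, p2; split.
- apply Rmult_le_reg_r with (PI ^ 4); [lra|].
  replace ((PI - 2) / PI ^ 4 * PI ^ 4) with (PI - 2) by (field; lra). lra.
- apply Rmult_lt_reg_r with (PI ^ 4); [lra|].
  replace ((PI - 2) / PI ^ 4 * PI ^ 4) with (PI - 2) by (field; lra). lra.
Qed.

(** * The factor of the derivative that carries the parameter *)

(** This is -(sin x / x)' / x^2, the value of 24 p for which [phi3 p] is
    stationary at [x]. *)
Definition slope (x : R) : R := (sin x - x * cos x) / x ^ 4.

Lemma sub_x_cos_pos (x : R) : 0 < x <= PI -> 0 < sin x - x * cos x.
Proof.
intros Hx.
destruct (MVT_cor2 (fun t => sin t - t * cos t) (fun t => t * sin t) 0 x)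
  as [c [Hc Hcx]]; [lra | | ].
- intros c _. apply is_derive_Reals. auto_derive; [easy | ring].
- rewrite sin_0 in Hc.
  assert (0 < sin c) by (apply sin_gt_0; lra).
  assert (0 < c * sin c * (x - 0)) by (repeat apply Rmult_lt_0_compat; lra).
  lra.
Qed.

(** Up to the positive factor x^5 this is the derivative of [slope].  It
    vanishes at 0, and its own derivative is the opposite of
    t ((sin t - t cos t) + sin t), which is positive. *)
Lemma slope_numerator_neg (x : R) : 0 < x < PI ->
  (x ^ 2 - 4) * sin x + 4 * x * cos x < 0.
Proof.
intros Hx.
destruct (MVT_cor2 (fun t => (t ^ 2 - 4) * sin t + 4 * t * cos t)
  (fun t => - (t * ((sin t - t * cos t) + sin t))) 0 x) as [c [Hc Hcx]].
- lra.
- intros c _. apply is_derive_Reals. auto_derive; [easy | ring].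
- assert (0 < sin c) by (apply sin_gt_0; lra).
  assert (0 < sin c - c * cos c) by (apply sub_x_cos_pos; lra).
  assert (0 < c * ((sin c - c * cos c) + sin c) * (x - 0))
    by (repeat apply Rmult_lt_0_compat; lra).
  rewrite sin_0 in Hc. lra.
Qed.

Lemma slope_decreasing (x y : R) : 0 < x < y -> y < PI -> slope y < slope x.
Proof.
intros Hxy Hy.
destruct (MVT_cor2 slope
  (fun t => ((t ^ 2 - 4) * sin t + 4 * t * cos t) / t ^ 5) x y)
  as [c [Hc Hcx]]; [lra | | ].
- intros c Hc. apply is_derive_Reals. unfold slope. auto_derive.
  + apply (pow_nonzero c 4); lra.
  + field; lra.
- assert (H := slope_numerator_neg c ltac:(lra)).
  assert (0 < / c ^ 5) by (apply Rinv_0_lt_compat, pow_lt; lra).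
  assert (0 < - ((c ^ 2 - 4) * sin c + 4 * c * cos c) * / c ^ 5 * (y - x))
    by (repeat apply Rmult_lt_0_compat; lra).
  unfold Rdiv in Hc. lra.
Qed.

Lemma slope_PI2 : slope (PI / 2) = 24 * p1.
Proof.
assert (HPI := PI_bounds).
unfold slope, p1. rewrite sin_PI2, cos_PI2. field; lra.
Qed.

(** * Monotonicity, end value and limit at 0 of phi3 *)

Lemma is_derive_phi3 (p x : R) : x <> 0 ->
  is_derive (phi3 p) x (x ^ 2 * (24 * p - slope x)).
Proof.
intros Hx. unfold phi3, slope. auto_derive; [easy | field; easy].
Qed.

Lemma phi3_decreasing (p m x y : R) : 24 * p <= slope m -> m < PI ->
  0 < x < y -> y <= m -> phi3 p y < phi3 p x.
Proof.
intros Hp Hm Hxy Hym.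
destruct (MVT_cor2 (phi3 p) (fun t => t ^ 2 * (24 * p - slope t)) x y)
  as [c [Hc Hcx]]; [lra | | ].
- intros c Hc. apply is_derive_Reals, is_derive_phi3. lra.
- assert (slope m < slope c) by (apply slope_decreasing; lra).
  assert (0 < c ^ 2 * (slope c - 24 * p) * (y - x))
    by (repeat apply Rmult_lt_0_compat; lra).
  lra.
Qed.

Lemma phi3_increasing (p m x y : R) : slope m <= 24 * p -> y < PI ->
  0 < m <= x -> x < y -> phi3 p x < phi3 p y.
Proof.
intros Hp Hm Hxy Hym.
destruct (MVT_cor2 (phi3 p) (fun t => t ^ 2 * (24 * p - slope t)) x y)
  as [c [Hc Hcx]]; [lra | | ].
- intros c Hc. apply is_derive_Reals, is_derive_phi3. lra.
- assert (slope c < slope m) by (apply slope_decreasing; lra).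
  assert (0 < c ^ 2 * (24 * p - slope c) * (y - x))
    by (repeat apply Rmult_lt_0_compat; lra).
  lra.
Qed.

Lemma phi3_PI2 (p : R) : phi3 p (PI / 2) = 0.
Proof.
assert (HPI := PI_bounds).
unfold phi3. rewrite sin_PI2. field; lra.
Qed.

Lemma cubic_pos (x : R) : 0 < x < PI / 2 -> 0 < PI ^ 3 - 8 * x ^ 3.
Proof.
intros Hx.
replace (PI ^ 3 - 8 * x ^ 3)
  with ((PI - 2 * x) * (PI ^ 2 + 2 * PI * x + 4 * x ^ 2)) by ring.
apply Rmult_lt_0_compat; [lra | nra].
Qed.

Lemma phi3_decreasing_p (p q x : R) : p < q -> 0 < x < PI / 2 ->
  phi3 q x < phi3 p x.
Proof.
intros Hpq Hx. unfold phi3. assert (H := cubic_pos x Hx). nra.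
Qed.

(** The limit of [phi3 p] at 0+, factored so that its sign and its dependence
    on [p] are visible. *)
Definition phi3_0 (p : R) : R := (p2 - p) * PI ^ 3.

Lemma phi3_0_eq (p : R) : phi3_0 p = 1 - 2 / PI - p * PI ^ 3.
Proof.
assert (HPI := PI_bounds). unfold phi3_0, p2. field; lra.
Qed.

Lemma phi3_0_decreasing (p q : R) : p < q -> phi3_0 q < phi3_0 p.
Proof.
intros H. unfold phi3_0. apply Rmult_lt_compat_r; [| lra].
apply pow_lt, PI_RGT_0.
Qed.

Lemma phi3_lim_0 (p : R) :
  filterlim (phi3 p) (at_right 0) (locally (phi3_0 p)).
Proof.
assert (HPI := PI_bounds).
assert (H : is_lim (phi3 p) 0 (1 - 2 / PI - p * (PI ^ 3 - 8 * 0 ^ 3))).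
{ unfold phi3.
  apply is_lim_minus'; [apply is_lim_minus' |].
  - apply is_lim_sinc_0.
  - apply is_lim_const.
  - apply (is_lim_continuity (fun t => p * (PI ^ 3 - 8 * t ^ 3))). reg. }
replace (phi3_0 p) with (1 - 2 / PI - p * (PI ^ 3 - 8 * 0 ^ 3))
  by (unfold phi3_0, p2; field; lra).
apply filterlim_filter_le_1 with (2 := H).
intros P [eps Heps]. exists eps. intros y Hy H0.
apply Heps; [exact Hy | apply Rgt_not_eq; exact H0].
Qed.

Lemma phi3_0_le (p b c : R) : 0 < b ->
  (forall x, 0 < x < b -> phi3 p x <= c) -> phi3_0 p <= c.
Proof.
intros Hb H.
apply (filterlim_le (F := at_right 0) (phi3 p) (fun _ => c)
  (Finite (phi3_0 p)) (Finite c)).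
- exists (mkposreal b Hb). intros y Hy H0. apply H.
  change (Rabs (y - 0) < b) in Hy. apply Rabs_def2 in Hy. lra.
- apply phi3_lim_0.
- apply filterlim_const.
Qed.

Lemma phi3_0_ge (p b c : R) : 0 < b ->
  (forall x, 0 < x < b -> c <= phi3 p x) -> c <= phi3_0 p.
Proof.
intros Hb H.
apply (filterlim_le (F := at_right 0) (fun _ => c) (phi3 p)
  (Finite c) (Finite (phi3_0 p))).
- exists (mkposreal b Hb). intros y Hy H0. apply H.
  change (Rabs (y - 0) < b) in Hy. apply Rabs_def2 in Hy. lra.
- apply filterlim_const.
- apply phi3_lim_0.
Qed.

(** The inequality is strict because [phi3 p x] < [phi3 p (x / 2)] already, and
    the limit dominates the latter value. *)
Lemma phi3_lt_0 (p m x : R) : 24 * p <= slope m -> m < PI ->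
  0 < x <= m -> phi3 p x < phi3_0 p.
Proof.
intros Hp Hm Hx.
apply Rlt_le_trans with (phi3 p (x / 2)).
- apply phi3_decreasing with m; lra.
- apply phi3_0_ge with (x / 2); [lra|]. intros y Hy.
  left; apply phi3_decreasing with m; lra.
Qed.

(** * The valley shape of phi3 *)

(** The equation is solved on [1, PI/2] after clearing the denominator: at
    PI/2 the value of [slope] is 24 [p1], below 24 p, and at 1 it is
    sin 1 - cos 1 = 0.301..., above 24 [p2] = 0.281.... *)
Lemma stationary_exists (p : R) : p1 < p <= p2 ->
  exists m, 0 < m < PI / 2 /\ slope m = 24 * p.
Proof.
intros Hp. assert (HPI := PI_bounds).
set (k := fun x => 24 * p * x ^ 4 - (sin x - x * cos x)).
assert (k1 : k 1 < 0).
{ unfold k. assert (Hs := sin_taylor 1 ltac:(lra)).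
  assert (Hc := cos_taylor 1 ltac:(lra)).
  destruct p2_decimals. lra. }
assert (k2 : 0 < k (PI / 2)).
{ unfold k. rewrite sin_PI2, cos_PI2.
  assert (H := slope_PI2). unfold slope in H. rewrite sin_PI2, cos_PI2 in H.
  assert (0 < (PI / 2) ^ 4) by (apply pow_lt; lra).
  assert (1 - PI / 2 * 0 = 24 * p1 * (PI / 2) ^ 4) by (rewrite <- H; field; lra).
  nra. }
destruct (IVT_gen k 1 (PI / 2) 0) as [m [Hm Hk]].
- unfold k; reg.
- rewrite Rmin_left, Rmax_right; lra.
- rewrite Rmin_left, Rmax_right in Hm by lra.
  assert (m <> PI / 2) by (intros ->; lra).
  exists m. split; [lra|]. unfold k in Hk. unfold slope.
  replace (sin m - m * cos m) with (24 * p * m ^ 4) by lra. field; lra.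
Qed.

Lemma valley_min (p m x : R) :
  0 < m < PI / 2 -> slope m = 24 * p ->
  0 < x < PI / 2 -> phi3 p m <= phi3 p x.
Proof.
intros Hm Hslope Hx. destruct (Rtotal_order x m) as [H | [-> | H]]; [| lra |]; left.
- apply phi3_decreasing with m; lra.
- apply phi3_increasing with m; lra.
Qed.

Lemma valley_right_neg (p m x : R) :
  0 < m < PI / 2 -> slope m = 24 * p ->
  m <= x < PI / 2 -> phi3 p x < 0.
Proof.
intros Hm Hslope Hx. rewrite <- (phi3_PI2 p). apply phi3_increasing with m; lra.
Qed.

(** Strict monotonicity on either side excludes any other local minimum: every
    neighbourhood of [n] contains a point [y] strictly nearer to [m], where
    [phi3 p] is smaller. *)
Lemma valley_local_min (p m : R) :
  0 < m < PI / 2 -> slope m = 24 * p ->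
  unique (local_min_on 0 (PI / 2) (phi3 p)) m.
Proof.
intros Hm Hslope. split.
- split; [exact Hm|]. apply filter_forall. intros x. exact (valley_min p m x Hm Hslope).
- intros n [Hn [eps Heps]]. assert (He := cond_pos eps).
  destruct (Rtotal_order m n) as [H | [H | H]]; [exfalso | easy | exfalso].
  + set (y := Rmax m (n - eps / 2)).
    assert (Hy : m <= y < n /\ n - eps / 2 <= y)
      by (unfold y, Rmax; destruct Rle_dec; lra).
    apply (Rlt_not_le (phi3 p n) (phi3 p y)).
    * apply phi3_increasing with m; lra.
    * apply Heps; [| lra]. apply Rabs_def1; unfold minus, plus, opp; simpl; lra.
  + set (y := Rmin m (n + eps / 2)).
    assert (Hy : n < y <= m /\ y <= n + eps / 2)
      by (unfold y, Rmin; destruct Rle_dec; lra).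
    apply (Rlt_not_le (phi3 p n) (phi3 p y)).
    * apply phi3_decreasing with m; lra.
    * apply Heps; [| lra]. apply Rabs_def1; unfold minus, plus, opp; simpl; lra.
Qed.

Lemma valley_neg (p m x : R) :
  0 < m < PI / 2 -> slope m = 24 * p ->
  phi3_0 p <= 0 -> 0 < x < PI / 2 -> phi3 p x < 0.
Proof.
intros Hm Hslope H0 Hx. destruct (Rle_lt_dec x m) as [H | H].
- apply Rlt_le_trans with (2 := H0). apply phi3_lt_0 with m; lra.
- apply valley_right_neg with m; lra.
Qed.

(** The zero lies on the descending side: the positive limit at 0 provides a
    positive value there, and the bottom is negative because [phi3 p] climbs
    back to 0 at PI/2. *)
Lemma valley_zero (p m : R) :
  0 < m < PI / 2 -> slope m = 24 * p ->
  0 < phi3_0 p ->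
  exists x0, 0 < x0 < PI / 2 /\ phi3 p x0 = 0 /\
    (forall x, 0 < x < x0 -> 0 < phi3 p x) /\
    (forall x, x0 < x < PI / 2 -> phi3 p x < 0).
Proof.
intros Hm Hslope H0.
assert (Hneg := valley_right_neg p m m Hm Hslope ltac:(lra)).
assert (Hpos : exists a, 0 < a < m /\ 0 < phi3 p a).
{ apply Classical_Prop.NNPP; intros Hno.
  apply (Rlt_not_le _ _ H0), phi3_0_le with m; [lra|].
  intros x Hx. apply Rnot_lt_le; intros H. apply Hno. exists x; easy. }
destruct Hpos as [a [Ha Hpa]].
(* This is x * phi3 p x without the division by x, continuous also at 0. *)
set (k := fun x => sin x - x * (2 / PI + p * (PI ^ 3 - 8 * x ^ 3))).
assert (Hk : forall x, 0 < x -> k x = x * phi3 p x)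
  by (intros x Hx; unfold k, phi3; field; lra).
destruct (IVT_gen k a m 0) as [x0 [Hx0 Hkx]].
- unfold k; reg.
- rewrite !Hk by lra. rewrite Rmin_right, Rmax_left; nra.
- rewrite Rmin_left, Rmax_right in Hx0 by lra.
  rewrite Hk in Hkx by lra.
  assert (Hz : phi3 p x0 = 0)
    by (destruct (Rmult_integral _ _ Hkx); [lra | easy]).
  exists x0. split; [lra|]. split; [exact Hz|]. split; intros x Hx.
  + rewrite <- Hz. apply phi3_decreasing with m; lra.
  + destruct (Rle_lt_dec x m) as [H | H]; [| apply valley_right_neg with m; lra].
    rewrite <- Hz. apply phi3_decreasing with m; lra.
Qed.

(** * Numerical enclosure of the balanced valley *)

(** The balance condition at [m] for the parameter [slope m / 24], multiplied
    by m^4 to make it continuous on the whole line. *)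
Definition balance (m : R) : R :=
  (1 - 4 / PI) * m ^ 4 + m ^ 3 * sin m
  - (sin m - m * cos m) * (2 * PI ^ 3 - 8 * m ^ 3) / 24.

Lemma balanceE (m : R) : 0 < m ->
  m ^ 4 * (phi3_0 (slope m / 24) + phi3 (slope m / 24) m) = balance m.
Proof.
intros Hm. assert (HPI := PI_bounds).
unfold balance, phi3_0, phi3, slope, p2. field; lra.
Qed.

(** The last digits are dictated by the error: a change of 1e-8 in [p] moves
    [phi3_0 p] by about 3e-7, and the root 1.1596809... must be enclosed to
    about 1e-6 for the six decimals of the error to be decided. *)
Lemma left_bracket :
  balance 1.1596804 < 0 /\ slope 1.1596804 < 24 * 0.010441277.
Proof.
destruct PI_pow_bounds as [H3 [_ HV]].
assert (Hs := sin_taylor 1.1596804 ltac:(lra)).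
assert (Hc := cos_taylor 1.1596804 ltac:(lra)).
unfold balance, slope.
set (s := sin _) in *; set (c := cos _) in *.
assert (Hs' : 0.916675433 < s < 0.916675434) by lra.
assert (Hc' : 0.399632519 < c < 0.399632520) by lra.
assert (HD : 0.453229431 < s - 1.1596804 * c < 0.453229435) by lra.
clearbody s c.
split; [| lra].
assert (H := mult_bounds 0.453229431 0.453229435
  (2 * 31.0062765 - 8 * 1.1596804 ^ 3) (2 * 31.006277 - 8 * 1.1596804 ^ 3)
  (s - 1.1596804 * c) (2 * PI ^ 3 - 8 * 1.1596804 ^ 3) ltac:(lra) ltac:(lra)).
unfold Rdiv in *. lra.
Qed.

Lemma right_bracket :
  0 < balance 1.159682 /\ 24 * 0.01044125 < slope 1.159682.
Proof.
destruct PI_pow_bounds as [H3 [_ HV]].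
assert (Hs := sin_taylor 1.159682 ltac:(lra)).
assert (Hc := cos_taylor 1.159682 ltac:(lra)).
unfold balance, slope.
set (s := sin _) in *; set (c := cos _) in *.
assert (Hs' : 0.916676072 < s < 0.916676073) by lra.
assert (Hc' : 0.399631052 < c < 0.399631053) by lra.
assert (HD : 0.453231132 < s - 1.159682 * c < 0.453231136) by lra.
clearbody s c.
split; [| lra].
assert (H := mult_bounds 0.453231132 0.453231136
  (2 * 31.0062765 - 8 * 1.159682 ^ 3) (2 * 31.006277 - 8 * 1.159682 ^ 3)
  (s - 1.159682 * c) (2 * PI ^ 3 - 8 * 1.159682 ^ 3) ltac:(lra) ltac:(lra)).
unfold Rdiv in *. lra.
Qed.

(** These bounds on [p] are narrower than its six decimals require; the six
    decimals of [phi3_0 p] need them. *)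
Lemma balanced_exists : exists p m,
  0.01044125 < p < 0.010441277 /\ 0 < m < PI / 2 /\ slope m = 24 * p /\
  phi3_0 p + phi3 p m = 0.
Proof.
assert (HPI := PI_bounds).
destruct left_bracket as [Ha Hpa], right_bracket as [Hb Hpb].
destruct (IVT_gen balance 1.1596804 1.159682 0) as [m [Hm Hz]].
- unfold balance; reg.
- rewrite Rmin_left, Rmax_right; lra.
- rewrite Rmin_left, Rmax_right in Hm by lra.
  assert (Hma : 1.1596804 < m) by (destruct (Req_dec m 1.1596804) as [-> |]; lra).
  assert (Hmb : m < 1.159682) by (destruct (Req_dec m 1.159682) as [-> |]; lra).
  assert (S1 := slope_decreasing 1.1596804 m ltac:(lra) ltac:(lra)).
  assert (S2 := slope_decreasing m 1.159682 ltac:(lra) ltac:(lra)).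
  exists (slope m / 24), m. repeat split; try lra.
  rewrite <- balanceE in Hz by lra.
  destruct (Rmult_integral _ _ Hz) as [H |]; [| easy].
  now destruct (pow_nonzero m 4 ltac:(lra)).
Qed.

(** * Minimax optimality of the balanced valley *)

(** If p < q, then [phi3_0 p] > [phi3_0 q] = - [phi3 q mq] >= - [phi3 q mp]
    > - [phi3 p mp] = [phi3_0 p]; the middle step says that [mq] is the bottom
    of its valley. *)
Lemma balanced_not_lt (p q mp mq : R) :
  0 < mp < PI / 2 -> 0 < mq < PI / 2 -> slope mq = 24 * q ->
  phi3_0 p + phi3 p mp = 0 -> phi3_0 q + phi3 q mq = 0 -> ~ p < q.
Proof.
intros Hmp Hmq Hq Bp Bq Hlt.
assert (H1 := phi3_0_decreasing p q Hlt).
assert (H2 := valley_min q mq mp Hmq Hq Hmp).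
assert (H3 := phi3_decreasing_p p q mp Hlt Hmp).
lra.
Qed.

Lemma error_ge (a b c : R) (f : R -> R) (x : R) : a < x < b -> c <= Rabs (f x) ->
  Rbar_le c (error a b f).
Proof.
intros Hx Hc. apply Rbar_le_trans with (Rabs (f x)); [exact Hc |].
apply (Lub_Rbar_correct (fun y => exists x, a < x < b /\ y = Rabs (f x))).
exists x; easy.
Qed.

(** The limit at 0+ is not a value of [phi3 p] on the interval, so it is
    compared with the error through the values that approach it. *)
Lemma error_ge_phi3_0 (p : R) : Rbar_le (phi3_0 p) (error 0 (PI / 2) (phi3 p)).
Proof.
assert (HPI := PI_bounds).
assert (H : forall x, 0 < x < PI / 2 ->
  Rbar_le (phi3 p x) (error 0 (PI / 2) (phi3 p))).
{ intros x Hx. apply error_ge with x; [exact Hx | apply Rle_abs]. }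
destruct (error 0 (PI / 2) (phi3 p)) as [l | |]; simpl in *.
- apply phi3_0_le with (PI / 2); [lra | exact H].
- easy.
- apply (H 1); lra.
Qed.

(** The bottom attains the error; the values elsewhere lie between the bottom
    and the limit at 0+. *)
Lemma error_balanced (p m : R) :
  0 < m < PI / 2 -> slope m = 24 * p -> phi3_0 p + phi3 p m = 0 ->
  error 0 (PI / 2) (phi3 p) = phi3_0 p.
Proof.
intros Hm Hs Hb. apply is_lub_Rbar_unique. split.
- intros y [x [Hx ->]]. apply Rabs_le. split.
  + assert (H := valley_min p m x Hm Hs Hx). lra.
  + destruct (Rle_lt_dec x m) as [H | H].
    * left. apply phi3_lt_0 with m; lra.
    * assert (phi3 p x < 0) by (apply valley_right_neg with m; lra).
      assert (phi3 p m < 0) by (apply valley_right_neg with m; lra). lra.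
- intros b Hub. assert (H := Hub (Rabs (phi3 p m)) (ex_intro _ m (conj Hm eq_refl))).
  apply Rbar_le_trans with (2 := H). simpl.
  assert (H' := Rle_abs (- phi3 p m)). rewrite Rabs_Ropp in H'. lra.
Qed.

(** Up to [p0] the limit at 0+ is at least [phi3_0 p0]; above [p0] the value at
    [m] has fallen below [phi3 p0 m] = - [phi3_0 p0]. *)
Lemma error_ge_balanced (p0 m p : R) :
  0 < m < PI / 2 -> phi3_0 p0 + phi3 p0 m = 0 ->
  Rbar_le (phi3_0 p0) (error 0 (PI / 2) (phi3 p)).
Proof.
intros Hm Hb. destruct (Rle_lt_dec p p0) as [H | H].
- apply Rbar_le_trans with (phi3_0 p); [| apply error_ge_phi3_0].
  destruct H as [H | ->]; [left; now apply phi3_0_decreasing | apply Rbar_le_refl].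
- apply error_ge with m; [exact Hm |].
  assert (H1 := phi3_decreasing_p p0 p m H Hm).
  assert (H2 := Rle_abs (- phi3 p m)). rewrite Rabs_Ropp in H2. lra.
Qed.

Lemma minimax_error_balanced (p0 m : R) : 0 < p0 ->
  0 < m < PI / 2 -> slope m = 24 * p0 -> phi3_0 p0 + phi3 p0 m = 0 ->
  minimax_error 0 (PI / 2) phi3 = phi3_0 p0.
Proof.
intros Hp Hm Hs Hb. apply Rbar_is_glb_unique. split.
- intros d [p [_ ->]]. now apply error_ge_balanced with m.
- intros b Hlow. apply Hlow. exists p0; split; [exact Hp |].
  symmetry. now apply error_balanced with m.
Qed.

Lemma Rabs_balance (p m : R) : 0 < m < PI / 2 -> slope m = 24 * p -> p < p2 ->
  Rabs (phi3_0 p) = Rabs (phi3 p m) <-> phi3_0 p + phi3 p m = 0.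
Proof.
intros Hm Hs Hp.
assert (H0 : 0 < phi3_0 p)
  by (apply Rmult_lt_0_compat; [lra | apply pow_lt, PI_RGT_0]).
assert (H1 : phi3 p m < 0) by (apply valley_right_neg with m; lra).
rewrite Rabs_pos_eq, Rabs_left by lra. lra.
Qed.

(** * The inequalities and the minimax approximant *)

Theorem mainTheorem6 :
  (leading_decimals p1 7 0.0068439 /\ leading_decimals p2 6 0.011719)
  /\
  (* (i) *)
  (forall p : R, 0 < p <= p1 ->
     forall x : R, 0 < x < PI / 2 ->
       sin x / x > 2 / PI + p1 * (PI ^ 3 - 8 * x ^ 3) /\
       2 / PI + p1 * (PI ^ 3 - 8 * x ^ 3) >= 2 / PI + p * (PI ^ 3 - 8 * x ^ 3))
  /\
  (* (ii) *)
  (forall p : R, p1 < p < p2 ->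
     exists x0 : R,
       unique (fun x => 0 < x < PI / 2 /\ phi3 p x = 0) x0 /\
       (forall x : R, 0 < x < x0 ->
          sin x / x > 2 / PI + p * (PI ^ 3 - 8 * x ^ 3)) /\
       (forall x : R, x0 < x < PI / 2 ->
          sin x / x < 2 / PI + p * (PI ^ 3 - 8 * x ^ 3)))
  /\
  (* (iii) *)
  (forall p : R, p2 <= p ->
     forall x : R, 0 < x < PI / 2 ->
       sin x / x < 2 / PI + p2 * (PI ^ 3 - 8 * x ^ 3) /\
       2 / PI + p2 * (PI ^ 3 - 8 * x ^ 3) <= 2 / PI + p * (PI ^ 3 - 8 * x ^ 3))
  /\
  (* (iv) [m p] is the point of minimum, (v) [phi0 p] is the limit at 0+ *)
  (exists m : R -> R,
     (forall p : R, p1 < p <= p2 ->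
        unique (local_min_on 0 (PI / 2) (phi3 p)) (m p))
     /\
     exists phi0 : R -> R,
       (forall p : R, 0 < p ->
          filterlim (phi3 p) (at_right 0) (locally (phi0 p))) /\
       exists p0 d0 : R,
         unique (fun p => p1 < p < p2 /\
                          Rabs (phi0 p) = Rabs (phi3 p (m p))) p0 /\
         leading_decimals p0 6 0.010441 /\
         d0 = Rabs (phi0 p0) /\
         d0 = Rabs (phi3 p0 (m p0)) /\
         leading_decimals d0 6 0.039635 /\
         Finite d0 = minimax_error 0 (PI / 2) phi3 /\
         is_minimax_approximant 0 (PI / 2) phi3 p0).
Proof.
assert (HPI := PI_bounds).
assert (D1 := p1_decimals); assert (D2 := p2_decimals).
split; [easy |].
split.
{ intros p Hp x Hx.
  assert (H : phi3 p1 (PI / 2) < phi3 p1 x)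
    by (apply phi3_decreasing with (PI / 2); rewrite ?slope_PI2; lra).
  rewrite phi3_PI2 in H. unfold phi3 in H. assert (Hc := cubic_pos x Hx).
  split; [lra | nra]. }
split.
{ intros p Hp.
  destruct (stationary_exists p ltac:(lra)) as [m [Hm Hs]].
  destruct (valley_zero p m Hm Hs) as [x0 [Hx0 [Hz [Hpos Hneg]]]].
  { apply Rmult_lt_0_compat; [lra | apply pow_lt; lra]. }
  exists x0. split; [split |].
  - easy.
  - intros x [Hx Hxz]. destruct (Rtotal_order x0 x) as [H | [H | H]]; [| easy |].
    + specialize (Hneg x ltac:(lra)). lra.
    + specialize (Hpos x ltac:(lra)). lra.
  - unfold phi3 in Hpos, Hneg.
    split; intros x Hx; [specialize (Hpos x Hx) | specialize (Hneg x Hx)]; lra. }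
split.
{ intros p Hp x Hx.
  unfold leading_decimals in D1, D2.
  destruct (stationary_exists p2 ltac:(lra)) as [m [Hm Hs]].
  assert (H : phi3 p2 x < 0).
  { apply valley_neg with m; [easy | easy | | easy]. unfold phi3_0. lra. }
  unfold phi3 in H. assert (Hc := cubic_pos x Hx). split; [lra | nra]. }
set (m := fun p =>
  epsilon (inhabits 0) (fun m => 0 < m < PI / 2 /\ slope m = 24 * p)).
assert (Hm : forall p, p1 < p <= p2 -> 0 < m p < PI / 2 /\ slope (m p) = 24 * p).
{ intros p Hp. apply (epsilon_spec (inhabits 0)), stationary_exists, Hp. }
exists m. split.
{ intros p Hp. apply valley_local_min; apply (Hm p Hp). }
exists phi3_0. split.
{ intros p _. apply phi3_lim_0. }
destruct balanced_exists as [p0 [m0 [Hp0 [Hm0 [Hs0 Hb0]]]]].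
unfold leading_decimals in *.
assert (Hp0' : p1 < p0 < p2) by lra.
assert (Em : m p0 = m0).
{ destruct (Hm p0 ltac:(lra)) as [Hm1 Hs1].
  destruct (valley_local_min p0 m0 Hm0 Hs0) as [_ U].
  symmetry. apply U. now apply valley_local_min. }
assert (Habs : Rabs (phi3_0 p0) = Rabs (phi3 p0 (m p0)))
  by (rewrite Em; apply Rabs_balance; lra).
assert (Hd : Rabs (phi3_0 p0) = phi3_0 p0).
{ apply Rabs_pos_eq, Rmult_le_pos; [lra | apply pow_le; lra]. }
exists p0, (Rabs (phi3_0 p0)).
split; [split |].
- easy.
- intros q [Hq Hqabs]. destruct (Hm q ltac:(lra)) as [Hmq Hsq].
  apply Rabs_balance in Hqabs; [| lra ..].
  assert (~ p0 < q) by now apply balanced_not_lt with m0 (m q).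
  assert (~ q < p0) by now apply balanced_not_lt with (m q) m0.
  lra.
- assert (HM := minimax_error_balanced p0 m0 ltac:(lra) Hm0 Hs0 Hb0).
  split; [lra |]. split; [easy |]. split; [easy |]. split; [| split].
  + rewrite Hd, phi3_0_eq.
    destruct PI_pow_bounds as [H3 [_ HV]].
    assert (H := mult_bounds 0.01044125 0.010441277 31.0062765 31.006277
      p0 (PI ^ 3) ltac:(lra) ltac:(lra)).
    unfold Rdiv. lra.
  + now rewrite Hd, HM.
  + split; [lra |]. rewrite HM. now apply error_balanced with m0.
Qed.
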